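(* Let $\phi:(0,\infty)\to\mathbb{R}_{\ge0}$ be a function and let $a_1,a_2,\dots$ be positive real numbers (scaling factors) with $a_n\to\infty$ such that $a_n^2/n$ converges to some $c\ge0$ as $n\to\infty$. Then the following are equivalent. (a) There is a sequence of well-behaved functions $\sigma_n$, $n=1,2,\dots$, such that $\phi$ is a limit shape of stable configurations of $(\sigma_n)$ under the scaling $(a_n)$. (b) $\phi$ is convex with $\int_0^\infty\phi(x)\,dx\le1$, and if $c>0$ then the right derivative $\phi_R'(x)$ is an integer multiple of $c$ for every $x>0$.
   Context: A configuration of $n$ cards is an integer partition $\lambda=(\lambda_1\ge\lambda_2\ge\cdots\ge\lambda_\ell>0)$ of $n$, extended by $\lambda_i=0$ for $i>\ell$. A function $\sigma$ from the positive integers to the nonnegative integers with $\sigma(h)\le h$ for all $h$ is well-behaved if $\sigma(1)=1$, $\sigma(h)$ is non-decreasing in $h$, and $h-\sigma(h)$ is non-decreasing in $h$. In a move of $\sigma$-Bulgarian solitaire, $\sigma(h)$ cards are picked from each nonempty pile of size $h$, all picked cards together form one new pile, and the resulting piles are sorted in weakly decreasing order (empty piles being discarded). A configuration is stable if a move leaves it unchanged; for well-behaved $\sigma$ there is at most one stable configuration for each number of cards, and there is always one with a single card. Given a sequence of well-behaved functions $\sigma_n$, let $n^*=n^*(n)$ be the largest $n'\le n$ for which a stable configuration of $\sigma_n$-Bulgarian solitaire with $n'$ cards exists, and let $\lambda^{(n^* )}$ be that stable configuration. The function $\phi$ is a limit shape of stable configurations of $(\sigma_n)$ under the scaling $(a_n)$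 if $$\frac{a_n}{n}\,\lambda^{(n^*(n))}_{\lfloor a_n x\rfloor+1}\to\phi(x)\quad\text{as } n\to\infty,\ \text{ for all } x>0.$$ *)

(* Defs.v *)
(* MathComp / MathComp-Analysis *)
From HB Require Import structures.
From mathcomp Require Import all_boot all_order all_algebra.
From mathcomp Require Import all_classical all_reals all_analysis.

Set Implicit Arguments.
Unset Strict Implicit.
Unset Printing Implicit Defensive.

Import Order.TTheory GRing.Theory Num.Theory.
Import numFieldNormedType.Exports.

Local Open Scope classical_set_scope.
Local Open Scope ring_scope.

(* The list is 0-indexed, so the part lambda_i is [nth 0 lam (i - 1)]; the
   default value 0 of [nth] is the extension by zeros. *)
Definition is_configuration (n : nat) (lam : seq nat) : Prop :=
  [/\ sorted geq lam, all (leq 1) lam & sumn lam = n].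

(* Functions on the positive integers are represented by functions on [nat]
   whose value at 0 is unconstrained and never used. *)
Definition well_behaved (sigma : nat -> nat) : Prop :=
  [/\ forall h, (0 < h)%N -> (sigma h <= h)%N,
      sigma 1%N = 1%N,
      forall h k, (0 < h)%N -> (h <= k)%N -> (sigma h <= sigma k)%N
    & forall h k, (0 < h)%N -> (h <= k)%N -> (h - sigma h <= k - sigma k)%N].

Definition bulgarian_move (sigma : nat -> nat) (lam : seq nat) : seq nat :=
  sort geq [seq h <- sumn (map sigma lam) :: [seq (h - sigma h)%N | h <- lam]
           | (0 < h)%N].

Definition is_stable_configuration (sigma : nat -> nat) (n : nat)
    (lam : seq nat) : Prop :=
  is_configuration n lam /\ bulgarian_move sigma lam = lam.

(* For [0 < n] and well-behaved [sigma] the maximum ranges over a nonempty set,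
   since the one-card configuration is stable. *)
Definition nstar (sigma : nat -> nat) (n : nat) : nat :=
  (\max_(m < n.+1 | `[< exists lam, is_stable_configuration sigma m lam >]) m)%N.

(* Stable configurations of well-behaved functions are unique for a given
   number of cards, so the choice made by [xget] is immaterial. *)
Definition stable_configuration (sigma : nat -> nat) (n : nat) : seq nat :=
  xget [::] [set lam | is_stable_configuration sigma n lam].

(* [Num.truncn] is the floor on nonnegative reals. *)
Definition is_limit_shape (R : realType) (sigma : nat -> nat -> nat)
    (a : nat -> R) (phi : R -> R) : Prop :=
  forall x : R, 0 < x ->
    (fun n : nat => a n / n%:R *
       (nth 0%N (stable_configuration (sigma n) (nstar (sigma n) n))
          (Num.truncn (a n * x)))%:R) @ \oo --> phi x.

Definition is_right_derivative (R : realType) (f : R -> R) (x l : R) : Prop :=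
  (fun h : R => (f (x + h) - f x) / h) @ 0^'+ --> l.

(* Main.v *)
(* A configuration is stable if and only if each pile is the preceding one minus
   the cards picked from it, so the stable configurations of well-behaved
   functions are exactly the convex integer sequences that decrease strictly
   down to zero.

   Hence a limit shape is convex, and Fatou's lemma bounds its integral. The
   integer differences, rescaled by [a_n ^ 2 / n], tend to the slopes, which is
   why these are multiples of [c] when [c > 0].

   Conversely, the drops of [phi] between the points [j / b] are multiplied by
   [H], where [H * b <= n], and rounded down. The sums of these integers form a
   convex sequence with at most [n] cards in all. If [c = 0], take [b = a_n] and
   [H = n / a_n]; rounding is then negligible. If [c > 0], take [b = sqrt (c n)]
   and [H = b / c], for which the drops are integers except in the cells where
   the slope changes. *)
Require Import Defs.
From HB Require Import structures.
From mathcomp Require Import all_boot all_order all_algebra.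
From mathcomp Require Import all_classical all_reals all_analysis.
From mathcomp Require Import measurable_realfun zify ring lra.
Import Order.TTheory GRing.Theory Num.Theory.
Import numFieldNormedType.Exports.
Local Open Scope classical_set_scope.

(** * Stable configurations *)

Lemma geq_trans : transitive geq.
Proof. by move=> y x z /= yx zy; exact: leq_trans zy yx. Qed.

(** In a weakly decreasing list the zeros come last, so discarding them changes no entry of the list
    extended by zeros. *)
Lemma nth_filter_pos_sorted (s : seq nat) (i : nat) :
  sorted geq s -> nth 0 [seq h <- s | 0 < h] i = nth 0 s i.
Proof.
elim: s i => [|x s IHs] //= i; rewrite (path_sortedE geq_trans).
case/andP => xs s_sorted; case: (posnP x) => [x0|x_gt0]; last first.
  by case: i => [|i] //=; exact: IHs.
have s0 k : nth 0 s k = 0.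
  case: (ltnP k (size s)) => [ks|]; last exact: nth_default.
  by move/allP: xs => /(_ _ (mem_nth 0 ks)) /=; rewrite x0 leqn0 => /eqP.
by rewrite IHs // s0; case: i => [|i] /=; rewrite ?s0.
Qed.

Lemma sorted_geq_nth (s : seq nat) (i j : nat) :
  sorted geq s -> i <= j -> nth 0 s j <= nth 0 s i.
Proof.
move=> s_sorted ij; case: (ltnP j (size s)) => [js|sj]; last first.
  by rewrite (nth_default _ sj).
apply: (sorted_leq_nth geq_trans leqnn 0 s_sorted) => //.
by rewrite inE; exact: leq_ltn_trans js.
Qed.

Lemma sumn_filter_pos (s : seq nat) : sumn [seq h <- s | 0 < h] = sumn s.
Proof. by elim: s => [|x s IHs] //=; case: (posnP x) => [->|_] /=; rewrite IHs. Qed.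

(** Termwise domination leaves no slack when the sums agree; both sums are taken over one common
    range, padded with zeros. *)
Lemma sumn_nth_eq (s t : seq nat) :
  (forall i, nth 0 s i <= nth 0 t i) -> sumn s = sumn t ->
  forall i, nth 0 s i = nth 0 t i.
Proof.
have sumnE N (u : seq nat) : size u <= N -> sumn u = \sum_(i < N) nth 0 u i.
  elim: N u => [|N IHN] [|x u] // uN; first by rewrite big_ord0.
    by rewrite big1 // => i _; exact: nth_nil.
  by rewrite big_ord_recl /= (IHN u).
move=> st; pose N := size s + size t.
rewrite (sumnE N s) ?leq_addr// (sumnE N t) ?leq_addl// => eq_sum i.
case: (ltnP i N) => [iN|]; last by rewrite /N => ?; rewrite !nth_default //; lia.
have : \sum_(k < N) nth 0 t k - \sum_(k < N) nth 0 s k == 0 by rewrite eq_sum subnn.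
rewrite -sumnB // sum_nat_eq0 => /forallP /(_ (Ordinal iN)) /= ; rewrite subn_eq0 => ts.
by apply/eqP; rewrite eqn_leq st.
Qed.

Section stable_configurations.
Variable sigma : nat -> nat.
Hypothesis sigma_wb : well_behaved sigma.

(** An empty pile has remainder 0 by truncated subtraction, whatever [sigma 0] is, so [h = 0] is
    included. *)
Let remainder_mono h k : h <= k -> h - sigma h <= k - sigma k.
Proof.
case: sigma_wb => _ _ _ mono; case: h => [|h] hk; first by rewrite sub0n.
exact: mono.
Qed.

Let sigma_gt0 h : 0 < h -> 0 < sigma h.
Proof. by case: sigma_wb => _ s1 mono _ h0; rewrite -s1 mono. Qed.

Let sorted_remainders lam :
  sorted geq lam -> sorted geq [seq h - sigma h | h <- lam].
Proof.
by move=> lam_sorted; rewrite sorted_map; apply: sub_sorted lam_sorted => x y /=;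
  exact: remainder_mono.
Qed.

Let nth_remainders lam i :
  nth 0 [seq h - sigma h | h <- lam] i = nth 0 lam i - sigma (nth 0 lam i).
Proof.
case: (ltnP i (size lam)) => [ilam|lami]; first exact: nth_map.
by rewrite [nth 0 lam i]nth_default // sub0n nth_default // size_map.
Qed.

(** All remainders are smaller than the largest pile [x], so [x] can only be the new pile. Once it
    is removed, the positive remainders and the other piles are sorted lists with the same
    entries. *)
Lemma stable_configuration_nth n lam : is_stable_configuration sigma n lam ->
  forall i, nth 0 lam i.+1 = nth 0 lam i - sigma (nth 0 lam i).
Proof.
case=> -[lam_sorted lam_pos _] move_lam i; rewrite -nth_remainders.
case: lam => [|x l] in lam_sorted lam_pos move_lam *; first by rewrite !nth_nil.
set m := sumn (map sigma (x :: l)) in move_lam.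
set L := map _ _.
have /permP/(_ (pred1 x)) : perm_eq [seq h <- m :: L | 0 < h] (x :: l).
  by rewrite -[X in perm_eq _ X]move_lam perm_sym perm_sort.
have x0 : 0 < x by case/andP: lam_pos.
have xl : all (geq x) l by move: lam_sorted; rewrite /= (path_sortedE geq_trans) => /andP[].
have xL : x \notin L.
  apply/mapP => -[h hl xE]; have hx : h <= x.
    by move: hl; rewrite inE => /orP[/eqP ->//|]; exact: (allP xl).
  have := sigma_gt0 _ x0; have := remainder_mono _ _ hx; lia.
have mx : m = x.
  apply/eqP; apply: contraT => mx.
  have : x \notin [seq h <- m :: L | 0 < h].
    by rewrite mem_filter inE negb_and negb_or eq_sym mx xL orbT.
  have -> : (x \notin [seq h <- m :: L | 0 < h]) = (x \notin x :: l).
    congr negb; apply: perm_mem.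
    by rewrite -[X in perm_eq _ X]move_lam perm_sym perm_sort.
  by rewrite mem_head.
move=> _.
have permL : perm_eq [seq h <- L | 0 < h] l.
  rewrite -(perm_cons x) -[X in perm_eq _ X]move_lam perm_sym /bulgarian_move.
  by rewrite perm_sort -/m -/L /= mx x0.
have <- : [seq h <- L | 0 < h] = l.
  apply: (sorted_eq geq_trans) => //.
  - by move=> a b /= /andP[ba ab]; apply/eqP; rewrite eqn_leq ab ba.
  - exact/(sorted_filter geq_trans)/sorted_remainders.
  - by move: lam_sorted => /= /path_sorted.
by apply: nth_filter_pos_sorted; exact: sorted_remainders.
Qed.

(** By the recurrence the positive remainders are the tail [l]; as a move conserves the number of
    cards, the new pile must be the head [x]. *)
Lemma stable_configuration_of_nth n lam : is_configuration n lam ->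
  (forall i, nth 0 lam i.+1 = nth 0 lam i - sigma (nth 0 lam i)) ->
  is_stable_configuration sigma n lam.
Proof.
move=> lam_conf lam_rec; split=> //; case: lam_conf => lam_sorted lam_pos _.
case: lam => [|x l] // in lam_sorted lam_pos lam_rec *.
rewrite /bulgarian_move; set m := sumn _; set L := map _ _.
have L_sorted : sorted geq L by exact: sorted_remainders.
have Ll : [seq h <- L | 0 < h] = l.
  have nthLl i : nth 0 [seq h <- L | 0 < h] i = nth 0 l i.
    by rewrite nth_filter_pos_sorted // nth_remainders -lam_rec.
  have pos_size (s t : seq nat) : all (leq 1) s ->
      (forall i, nth 0 s i = nth 0 t i) -> size s <= size t.
    move=> s_pos st; case: leqP => // ts.
    by move/(all_nthP 0): s_pos => /(_ _ ts); rewrite st nth_default.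
  have l_pos : all (leq 1) l by case/andP: lam_pos.
  apply: (@eq_from_nth _ 0) => [|i _]; last exact: nthLl.
  by apply/eqP; rewrite eqn_leq; apply/andP; split; apply: pos_size => //; exact: filter_all.
have mx : m = x.
  have : m + sumn L = x + sumn l.
    have split_sum s : all (leq 1) s ->
        sumn (map sigma s) + sumn [seq h - sigma h | h <- s] = sumn s.
      elim: s => [|y s IHs] //= /andP[y0 /IHs].
      by case: sigma_wb => /(_ _ y0) ? _ _ _; lia.
    exact: split_sum lam_pos.
  by rewrite -[sumn L]sumn_filter_pos Ll; lia.
have -> : [seq h <- m :: L | 0 < h] = x :: l.
  by rewrite -cat1s filter_cat Ll mx; case/andP: lam_pos => /= ->.
by apply: sorted_sort => //; exact: geq_trans.
Qed.

(** The recurrence preserves order, since remainders are monotone in the pile size. Hence the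
    configuration with the larger first pile dominates termwise, and equality of the sums does the
    rest. *)
Lemma stable_configuration_uniq n lam mu :
  is_stable_configuration sigma n lam -> is_stable_configuration sigma n mu ->
  forall i, nth 0 lam i = nth 0 mu i.
Proof.
move: lam mu.
suff le_case lam mu : nth 0 lam 0 <= nth 0 mu 0 ->
    is_stable_configuration sigma n lam -> is_stable_configuration sigma n mu ->
    forall i, nth 0 lam i = nth 0 mu i.
  move=> lam mu lam_st mu_st; case: (leqP (nth 0 lam 0) (nth 0 mu 0)) => [|/ltnW] le0.
    exact: le_case.
  by move=> i; apply/esym/le_case.
move=> le0 lam_st mu_st; apply: sumn_nth_eq; last first.
  by case: lam_st mu_st => -[_ _ ->] _ [[_ _ ->]].
elim=> [|i IHi] //.
by rewrite !(stable_configuration_nth _ _ lam_st, stable_configuration_nth _ _ mu_st)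
  remainder_mono.
Qed.

Lemma stable_configuration_nstarP n :
  is_stable_configuration sigma (nstar sigma n)
    (stable_configuration sigma (nstar sigma n)).
Proof.
(* The empty configuration of 0 cards is stable, so the maximum is over a nonempty set and is
   attained. *)
have stable0 : is_stable_configuration sigma 0 [::] by split.
pose P (m : 'I_n.+1) := `[< exists lam, is_stable_configuration sigma m lam >].
have [m /asboolP[lam lam_st] ->] : {m : 'I_n.+1 | P m & nstar sigma n = m}.
  have P0 : P ord0 by apply/asboolP; exists [::].
  rewrite /nstar (bigop.bigmax_eq_arg ord0) //.
  by case: arg_maxnP => // m Pm _; exists m.
exact: (xgetPex [::] (ex_intro _ lam lam_st)).
Qed.

Lemma nstar_le n : nstar sigma n <= n.
Proof. by apply/bigmax_leqP => m _; rewrite -ltnS. Qed.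

Lemma nstar_eq n lam : is_stable_configuration sigma n lam -> nstar sigma n = n.
Proof.
move=> lam_st; apply/eqP; rewrite eqn_leq nstar_le /=.
apply: (@leq_bigmax_cond _ _ (fun m : 'I_n.+1 => m : nat) ord_max).
by apply/asboolP; exists lam.
Qed.

Lemma nth_stable_configuration n lam : is_stable_configuration sigma n lam ->
  forall i, nth 0 (stable_configuration sigma (nstar sigma n)) i = nth 0 lam i.
Proof.
move=> lam_st; rewrite (nstar_eq _ _ lam_st).
apply: stable_configuration_uniq (lam_st).
exact: (xgetPex [::] (ex_intro _ lam lam_st)).
Qed.

(** The drop after a pile is the number of cards picked from it, and [sigma] is non-decreasing. *)
Lemma stable_configuration_convex n lam : is_stable_configuration sigma n lam ->
  forall i, nth 0 lam i.+1 - nth 0 lam i.+2 <= nth 0 lam i - nth 0 lam i.+1.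
Proof.
move=> lam_st i; rewrite !(stable_configuration_nth _ _ lam_st).
case: lam_st => -[lam_sorted _ _] _.
set x := nth 0 lam i.
(* An empty next pile is treated apart, since [sigma 0] is arbitrary. *)
case: (posnP (x - sigma x)) => [->|y0]; first by rewrite sub0n.
case: sigma_wb => sigma_le _ sigma_mono _.
have := sigma_mono _ x y0 (leq_subr _ _).
have := sigma_le _ y0; lia.
Qed.

End stable_configurations.

(** The suffix sums [g] of [d] form a stable configuration as soon as [sigma (g i) = d i]. It
    remains to extend [sigma] to the other sizes with [sigma 1 = 1] and increments 0 or 1, which
    makes it well-behaved. *)
Lemma sigma_of_differences (d : nat -> nat) (N n : nat) :
  0 < n -> (forall i j, i <= j -> d j <= d i) -> (forall j, N <= j -> d j = 0) ->
  \sum_(i < N) \sum_(i <= j < N) d j = n ->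
  exists sigma, well_behaved sigma /\ forall i,
    nth 0 (stable_configuration sigma (nstar sigma n)) i = \sum_(i <= j < N) d j.
Proof.
move=> n0 d_mono d0; set g := fun i => \sum_(i <= j < N) d j => g_sum.
have gN i : N <= i -> g i = 0 by move=> Ni; rewrite /g big_geq.
have gS i : g i = d i + g i.+1.
  case: (ltnP i N) => [iN|Ni]; first by rewrite /g big_ltn.
  by rewrite !gN ?d0 // ltnW.
have g_mono i j : i <= j -> g j <= g i.
  move/subnK <-; elim: (j - i) => [|k IHk] //; rewrite addSn.
  by rewrite (leq_trans _ IHk) // [leqRHS]gS leq_addl.
(* Each term grows by at most one from [h] to [h.+1], and hence so does the
   maximum; at [h = g i] it is attained by the term of index [i]. *)
pose sigma h := \max_(j < N) minn (d j) (h - g j.+1).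
have sigma_le h : sigma h <= h.
  by apply/bigmax_leqP => j _; exact: leq_trans (geq_minr _ _) (leq_subr _ _).
have sigma_mono h k : h <= k -> sigma h <= sigma k.
  move=> hk; apply/bigmax_leqP => j _; apply: leq_trans (leq_bigmax j).
  by rewrite leq_min geq_minl (leq_trans (geq_minr _ _)) // leq_sub2r.
have sigmaS h : sigma h.+1 <= (sigma h).+1.
  apply/bigmax_leqP => j _.
  have := @leq_bigmax _ (fun j : 'I_N => minn (d j) (h - g j.+1)) j.
  rewrite -/(sigma h); lia.
have sigmag i : sigma (g i) = d i.
  apply/eqP; rewrite eqn_leq; apply/andP; split.
    apply/bigmax_leqP => j _; case: (leqP i j) => ij.
      by rewrite (leq_trans (geq_minl _ _)) // d_mono.
    by have := g_mono _ _ ij; lia.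
  case: (ltnP i N) => [iN|/d0 -> //].
  apply: leq_trans (leq_bigmax (Ordinal iN)); rewrite /= gS; lia.
have dN0 : 0 < d 0.
  rewrite lt0n; apply/eqP => d00; move: n0; rewrite -g_sum big1 // => i _.
  by rewrite big1 // => j _; apply/eqP; rewrite -leqn0 -d00 d_mono.
(* Let [k] be the index of the last positive difference: there [g k.+1 = 0], so the term of index
   [k] equals 1 at [h = 1]. *)
have sigma1 : sigma 1 = 1.
  have ex_pos : exists j, d j == 0 by exists N; rewrite d0.
  have := ex_minnP ex_pos; case=> -[|k] /eqP dk k_min; first by rewrite dk in dN0.
  have dk0 : 0 < d k by rewrite lt0n; apply/eqP => /eqP /k_min; rewrite ltnn.
  have kN : k < N by rewrite ltnNge; apply/negP => /d0 E; rewrite E in dk0.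
  have gk : g k.+1 = 0.
    rewrite /g big_nat_cond big1 // => j; rewrite andbT => /andP[kj _].
    by apply/eqP; rewrite -leqn0 -dk d_mono.
  apply/eqP; rewrite eqn_leq sigma_le /=.
  apply: leq_trans (leq_bigmax (Ordinal kN)); rewrite /= gk; lia.
have sigma_wb : well_behaved sigma.
  split=> // [h k _|h k _]; first exact: sigma_mono.
  move/subnK <-; elim: (k - h) => [|m IHm] //; rewrite addSn (leq_trans IHm) //.
  by have := sigmaS (m + h); have := sigma_le (m + h); lia.
exists sigma; split=> // i.
pose lam := [seq h <- mkseq g N | 0 < h].
have mkg_sorted : sorted geq (mkseq g N).
  apply/(sortedP 0) => k; rewrite size_mkseq => kN.
  by rewrite !nth_mkseq ?(ltnW kN) //=; exact: g_mono.
have nth_lam k : nth 0 lam k = g k.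
  rewrite nth_filter_pos_sorted //; case: (ltnP k N) => [kN|Nk].
    by rewrite nth_mkseq.
  by rewrite nth_default ?size_mkseq // gN.
have lam_st : is_stable_configuration sigma n lam.
  apply: stable_configuration_of_nth => //; last first.
    by move=> k; rewrite !nth_lam sigmag [in RHS]gS addKn.
  split; [exact/(sorted_filter geq_trans)| exact: filter_all |].
  rewrite sumn_filter_pos sumnE big_map -g_sum /index_iota.
  by rewrite -(big_mkord xpredT g) /index_iota subn0.
by rewrite (nth_stable_configuration _ sigma_wb _ _ lam_st) nth_lam.
Qed.

(** * Convex functions on the positive reals *)

Local Open Scope ring_scope.

(** Convexity with denominators cleared, a form suited to scaling and limits; the weight of [x] in
    the combination giving [y] is [(z - y) / (z - x)]. *)
Lemma convex_function_gt0E (R : realType) (phi : R -> R) :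
  convex_function (`]0, +oo[%classic : set R^o) phi <->
  forall x y z : R, 0 < x -> x < y -> y < z ->
    (z - x) * phi y <= (z - y) * phi x + (y - x) * phi z.
Proof.
split=> [phi_conv x y z x0 xy yz|phi_conv t x y].
  have xz : 0 < z - x by rewrite subr_gt0 (lt_trans xy).
  have t01 : 0 <= (z - y) / (z - x) <= 1.
    by rewrite ler_pdivrMr // divr_ge0 /=; lra.
  pose t : {i01 R} := Itv01 (andP t01).1 (andP t01).2.
  have x_pos : x \in (`]0, +oo[%classic : set R) by rewrite inE/= in_itv/= x0.
  have z_pos : z \in (`]0, +oo[%classic : set R).
    by rewrite inE/= in_itv/= (lt_trans x0) // (lt_trans xy).
  have := phi_conv t x z x_pos z_pos; rewrite !convRE /= /unstable.onem.
  have convE : (z - y) / (z - x) * x + (1 - (z - y) / (z - x)) * z = y.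
    by field; rewrite gt_eqF.
  rewrite [X in phi X](_ : _ = y); last by rewrite -[RHS]convE.
  rewrite -(ler_pM2l xz) => /le_trans; apply.
  by rewrite le_eqVlt; apply/orP; left; apply/eqP; field; rewrite gt_eqF.
rewrite !inE /= !in_itv /= !andbT => x0 y0; rewrite !convRE.
rewrite [X in phi X](_ : _ = t%:num * x + (1 - t%:num) * y); last by [].
have s0 : 0 <= t%:num by exact: ge0.
have s1 : t%:num <= 1 by exact: le1.
move: (t%:num) s0 s1 => s s0 s1; move: (x : R) (y : R) x0 y0 => {}x {}y x0 y0.
have [->|s_neq0] := eqVneq s 0; first by rewrite /unstable.onem !(mul0r, add0r, subr0, mul1r).
have [->|s_neq1] := eqVneq s 1; first by rewrite /unstable.onem !(subrr, mul0r, addr0, mul1r).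
have s_gt0 : 0 < s by rewrite lt_def s_neq0.
have s_lt1 : 0 < 1 - s by rewrite subr_gt0 lt_neqAle s_neq1.
change (phi (s * x + (1 - s) * y) <= s * phi x + (1 - s) * phi y).
have [xy|yx|->] := ltgtP x y; last first.
- by rewrite le_eqVlt; apply/orP; left; apply/eqP; rewrite -!mulrDl addrC subrK !mul1r.
- rewrite -(ler_pM2l (_ : 0 < x - y)) ?subr_gt0 //.
  have phi_xy := @phi_conv y (s * x + (1 - s) * y) x y0.
  suff -> : (x - y) * (s * phi x + (1 - s) * phi y) =
    (x - (s * x + (1 - s) * y)) * phi y + (s * x + (1 - s) * y - y) * phi x.
    by apply: phi_xy; nra.
  by ring.
- rewrite -(ler_pM2l (_ : 0 < y - x)) ?subr_gt0 //.
  have phi_xy := @phi_conv x (s * x + (1 - s) * y) y x0.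
  suff -> : (y - x) * (s * phi x + (1 - s) * phi y) =
    (y - (s * x + (1 - s) * y)) * phi x + (s * x + (1 - s) * y - x) * phi y.
    by apply: phi_xy; nra.
  by ring.
Qed.

Section convex_on_positive_reals.
Variables (R : realType) (phi : R -> R).
Hypothesis phi_convex : forall x y z : R, 0 < x -> x < y -> y < z ->
  (z - x) * phi y <= (z - y) * phi x + (y - x) * phi z.

(** The chords over [[x - h, x]] and [[x, x + h]] bound the difference quotients near [x], so [phi]
    is Lipschitz at [x]; the choice [h = x / 2] keeps [x - h] positive. *)
Lemma convex_gt0_continuous (x : R) : 0 < x -> {for x, continuous phi}.
Proof.
move=> x0; set h := x / 2.
set K := `|phi (x - h) - phi x| + `|phi (x + h) - phi x|.
have h0 : 0 < h by rewrite divr_gt0.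
have hx : h < x by rewrite /h; lra.
have K0 : 0 <= K by rewrite addr_ge0.
have phi_lip y : x - h < y -> y < x + h -> h * `|phi x - phi y| <= K * `|x - y|.
  have w1 : phi (x - h) - phi x <= K.
    by rewrite (le_trans (ler_norm _)) // lerDl.
  have z1 : phi (x + h) - phi x <= K.
    by rewrite (le_trans (ler_norm _)) // lerDr.
  move=> y1 y2; rewrite -(ger0_norm (ltW h0)) -normrM ler_norml.
  have w0 : 0 < x - h by lra.
  have [xy|yx|->] := ltgtP x y; last by rewrite !subrr normr0 !mulr0 oppr0 lexx.
  - have := @phi_convex (x - h) x y w0 _ xy.
    have := @phi_convex x y (x + h) x0 xy y2.
    rewrite (ltr0_norm (_ : x - y < 0)); last by lra.
    move=> Hz /(_ ltac:(lra)) Hw; apply/andP; split; nra.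
  - have := @phi_convex (x - h) y x w0 y1 yx.
    have := @phi_convex y x (x + h) _ yx _.
    rewrite (gtr0_norm (_ : 0 < x - y)); last by lra.
    move=> /(_ ltac:(lra) ltac:(lra)) Hz Hw; apply/andP; split; nra.
apply/cvgrPdist_le => e e0.
(* [K] may be 0, hence the denominator [K + 1]. *)
have d0 : 0 < Num.min h (h * e / (K + 1)).
  by rewrite lt_min h0 divr_gt0 ?mulr_gt0 // ltr_wpDl.
near=> y.
have : `|x - y| < Num.min h (h * e / (K + 1)).
  by near: y; apply: (@cvgr_dist_lt _ _ _ _ _ id x) => //; exact: cvg_id.
rewrite lt_min => /andP[xyh].
rewrite ltr_pdivlMr ?ltr_wpDl // => xye.
move: (xyh); rewrite ltr_norml => /andP[xyh1 xyh2].
rewrite -(ler_pM2l h0); apply: le_trans (phi_lip y _ _) _; [lra|lra|].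
apply: le_trans (ltW xye); rewrite mulrC ler_wpM2l //; lra.
Unshelve. all: by end_near. Qed.

End convex_on_positive_reals.

Section integrable_convex.
Variables (R : realType) (phi : R -> R).
Hypothesis phi_ge0 : forall x : R, 0 < x -> 0 <= phi x.
Hypothesis phi_convex : forall x y z : R, 0 < x -> x < y -> y < z ->
  (z - x) * phi y <= (z - y) * phi x + (y - x) * phi z.
Hypothesis phi_int : (\int[lebesgue_measure]_(x in (`]0%R, +oo[%classic : set R))
  (phi x)%:E <= 1)%E.

Let measurable_phi : measurable_fun (`]0, +oo[%classic : set R) phi.
Proof.
apply: open_continuous_measurable_fun.
  exact: interval_open.
move=> x; rewrite inE /= in_itv /= andbT => x0.
exact: convex_gt0_continuous.
Qed.

Let phi_itv_ge0 (x y t : R) : 0 <= x -> (`]x, y]%classic : set R) t ->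
  (0 <= (phi t)%:E)%E.
Proof.
by move=> x0; rewrite /= in_itv/= lee_fin => /andP[xt _]; rewrite phi_ge0 // (le_lt_trans x0).
Qed.

Let measurable_phi_itv (x y : R) : 0 <= x ->
  measurable_fun (`]x, y]%classic : set R) (fun t => (phi t)%:E).
Proof.
move=> x0; apply/measurable_EFinP; apply: measurable_funS measurable_phi => // t /=.
by rewrite !in_itv /= andbT => /andP[xt _]; exact: le_lt_trans xt.
Qed.

Let le_integral_itv (c x y : R) : 0 <= x -> x <= y -> 0 <= c ->
  (forall t, x < t -> t <= y -> c <= phi t) ->
  (((y - x) * c)%:E <=
   \int[lebesgue_measure]_(t in (`]x, y]%classic : set R)) (phi t)%:E)%E.
Proof.
move=> x0 xy c0 phi_c.
have -> : ((y - x) * c)%:E =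
    (\int[lebesgue_measure]_(t in (`]x, y]%classic : set R)) (cst c%:E t))%E.
  rewrite integral_cst // [X in (_ * X)%E](_ : _ = (y - x)%:E).
    by rewrite -EFinM mulrC.
  rewrite [LHS]lebesgue_measure_itv /= lte_fin; case: ltP => // yx.
  by rewrite (@le_anti _ _ x y) ?xy // subrr.
apply: ge0_le_integral => //; first exact: measurable_phi_itv.
by move=> t /=; rewrite in_itv /= lee_fin => /andP[xt ty]; exact: phi_c.
Qed.

Let integral_itv_le1 (x y : R) : 0 <= x ->
  (\int[lebesgue_measure]_(t in (`]x, y]%classic : set R)) (phi t)%:E <= 1)%E.
Proof.
move=> x0; apply: le_trans phi_int; apply: ge0_subset_integral => //.
    exact/measurable_EFinP.
  by move=> t /=; rewrite in_itv /= andbT lee_fin => /phi_ge0.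
by move=> t /=; rewrite !in_itv /= andbT => /andP[xt _]; exact: le_lt_trans xt.
Qed.

(** By convexity an increase would persist and keep [phi] above [phi y > 0] everywhere beyond [y],
    against the bound on the integral. *)
Lemma integrable_convex_nonincreasing (x y : R) : 0 < x -> x <= y -> phi y <= phi x.
Proof.
move=> x0; rewrite le_eqVlt => /predU1P[->//|xy]; rewrite leNgt; apply/negP => phi_xy.
have phiy0 : 0 < phi y by rewrite (le_lt_trans _ phi_xy) // phi_ge0.
have y0 : 0 < y := lt_trans x0 xy.
have phi_yz z : y < z -> phi y <= phi z.
  move=> yz; have := @phi_convex _ _ _ x0 xy yz => phi_xyz.
  rewrite -(ler_pM2l (_ : 0 < y - x)) ?subr_gt0 //; nra.
(* With this length the integral over []y, z]] is at least [(z - y) * phi y = 2]. *)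
pose z := y + 2 / phi y.
have yz : y < z by rewrite ltrDl divr_gt0.
have : (((z - y) * phi y)%:E <= 1%:E)%E.
  apply: le_trans (integral_itv_le1 y z (ltW y0)).
  apply: le_integral_itv; rewrite ?ltW // => t yt _; exact: phi_yz.
rewrite lee_fin /z addrC addKr mulfVK ?gt_eqF //; lra.
Qed.

(** As [phi] is nonincreasing, its value at the right endpoint is a lower bound on each cell. *)
Lemma riemann_sum_le_integral (h : R) (m : nat) : 0 < h ->
  h * (\sum_(i < m) phi (i.+1%:R * h)) <= 1.
Proof.
move=> h0; rewrite -lee_fin.
suff : ((h * (\sum_(i < m) phi (i.+1%:R * h)))%:E <=
  \int[lebesgue_measure]_(t in (`]0%R, (m%:R * h)%R]%classic : set R)) (phi t)%:E)%E.
  by move/le_trans; apply; exact: integral_itv_le1.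
elim: m => [|m IHm].
  rewrite big_ord0 mulr0; apply: integral_ge0 => t.
  exact: phi_itv_ge0.
have mh0 : 0 <= m%:R * h by rewrite mulr_ge0 // ltW.
have mhS : m%:R * h <= m.+1%:R * h by rewrite ler_pM2r // ler_nat.
rewrite big_ord_recr /= mulrDr EFinD.
rewrite (@itv_bndbnd_setU _ _ (BRight 0) (BRight (m%:R * h)) (BRight (m.+1%:R * h))) //.
rewrite ge0_integral_setU //=; last 3 first.
- apply: measurable_funS (measurable_phi_itv 0 (m.+1%:R * h) (lexx 0)) => //.
  move=> t [|] /=; rewrite !in_itv /= => /andP[t1 t2]; apply/andP; split=> //.
    exact: le_trans t2 mhS.
  exact: le_lt_trans t1.
- by move=> t []; exact: phi_itv_ge0.
- apply/disj_setPS => t [] /=; rewrite !in_itv /= => /andP[_ t1] /andP[t2 _].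
  by move: (lt_le_trans t2 t1); rewrite ltxx.
apply: leeD => //.
rewrite -[X in (X * _)%:E](_ : m.+1%:R * h - m%:R * h = h); last first.
  by rewrite -mulrBl -natrB // subSnn mul1r.
apply: le_integral_itv => //.
  by rewrite phi_ge0 // mulr_gt0.
move=> t mt tS; apply: integrable_convex_nonincreasing => //.
exact: le_lt_trans mt.
Qed.

(** A Riemann sum with one rectangle; this decay controls the tails of the discretizations. *)
Lemma integrable_convex_le_inv (x : R) : 0 < x -> x * phi x <= 1.
Proof.
by move=> x0; have := riemann_sum_le_integral x 1 x0; rewrite big_ord1 mul1r.
Qed.

End integrable_convex.

(** * Discretization of a convex function *)

Section discretization.
Variables (R : realType) (phi : R -> R).
Hypothesis phi_ge0 : forall x : R, 0 < x -> 0 <= phi x.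
Hypothesis phi_convex : forall x y z : R, 0 < x -> x < y -> y < z ->
  (z - x) * phi y <= (z - y) * phi x + (y - x) * phi z.
Hypothesis phi_int : (\int[lebesgue_measure]_(x in (`]0%R, +oo[%classic : set R))
  (phi x)%:E <= 1)%E.
Variables (n : nat) (H b : R).
Hypotheses (n_gt0 : (0 < n)%N) (H_ge0 : 0 <= H) (b_gt0 : 0 < b).
Hypothesis Hb_le : H * b <= n%:R.

(** Sampling at the right endpoints of the cells avoids 0, where [phi] may blow up, and keeps the
    sums below the integral. *)
Let f (i : nat) : R := H * phi (i.+1%:R / b).
Let e (j : nat) : nat := Num.truncn (f j - f j.+1).

Let pt_gt0 i : 0 < i.+1%:R / b. Proof. by rewrite divr_gt0. Qed.

Let pt_step k : k.+2%:R / b = k.+1%:R / b + b^-1.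
Proof. by rewrite -(natr1 k.+1) mulrDl mul1r. Qed.

Let f_ge0 i : 0 <= f i. Proof. by rewrite mulr_ge0 // phi_ge0. Qed.

Let f_mono i j : (i <= j)%N -> f j <= f i.
Proof.
move=> ij; rewrite ler_wpM2l //.
apply: (integrable_convex_nonincreasing _ phi phi_ge0 phi_convex phi_int) => //.
by rewrite ler_pM2r ?invr_gt0 // ler_nat.
Qed.

Let f_convex i : f i.+1 - f i.+2 <= f i - f i.+1.
Proof.
rewrite -!mulrBr ler_wpM2l //.
have b1 : 0 < b^-1 by rewrite invr_gt0.
have := phi_convex _ (i.+2%:R / b) (i.+3%:R / b) (pt_gt0 i).
rewrite (pt_step i.+1) (pt_step i) => /(_ ltac:(lra) ltac:(lra)).
set x := i.+1%:R / b; set u := b^-1 => phi_u.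
rewrite -(ler_pM2l b1) -/u; nra.
Qed.

(** The decay [x * phi x <= 1] gives [f i <= H * b / i.+1 <= n / i.+1]. *)
Let f_tail i : (n <= i)%N -> f i < 1.
Proof.
move=> ni; have := integrable_convex_le_inv _ phi phi_ge0 phi_convex phi_int _ (pt_gt0 i).
move=> phi_le; have fi : f i * i.+1%:R <= n%:R.
  apply: le_trans Hb_le; have -> : f i * i.+1%:R = (H * b) * (i.+1%:R / b * phi (i.+1%:R / b)).
    by rewrite /f; field; rewrite gt_eqF.
  by rewrite ler_piMr // mulr_ge0 // ltW.
rewrite ltNge; apply/negP => f1.
have : i.+1%:R <= n%:R :> R by apply: le_trans fi; rewrite ler_peMl.
by rewrite ler_nat ltnNge ni.
Qed.

Let e_le j : (e j)%:R <= f j - f j.+1.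
Proof. by rewrite truncn_le subr_ge0 f_mono. Qed.

Let e_mono i j : (i <= j)%N -> (e j <= e i)%N.
Proof.
move/subnK <-; elim: (j - i)%N => [|k IHk] //; rewrite addSn.
by apply: leq_trans IHk; exact/le_truncn/f_convex.
Qed.

Let e_tail j : (n <= j)%N -> e j = 0%N.
Proof.
move=> nj; apply/eqP; rewrite -leqn0 truncn_le_nat.
by apply: le_lt_trans (f_tail j nj); rewrite lerBlDr lerDl.
Qed.

Let telescope_f i m : (i <= m)%N -> \sum_(i <= j < m) (f j - f j.+1) = f i - f m.
Proof.
move=> im; rewrite (telescope_sumr_eq (fun j => - f j)) // => [|j _].
  by rewrite opprK addrC.
by rewrite opprK addrC.
Qed.

Let sum_e_le i m : (\sum_(i <= j < m) e j)%:R <= f i.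
Proof.
case: (leqP i m) => [im|mi]; last by rewrite big_geq // ltnW.
rewrite natr_sum; apply: (@le_trans _ _ (f i - f m)); last by rewrite lerBlDr lerDl.
by rewrite -telescope_f // ler_sum.
Qed.

(** Telescoping bounds each inner sum by [f i], and the Riemann sum of step [b^-1] bounds the sum of
    the [f i] by [H * b]. *)
Let mass_le : (\sum_(i < n) \sum_(i <= j < n) e j <= n)%N.
Proof.
rewrite -(@ler_nat R) natr_sum; apply: le_trans Hb_le.
apply: (@le_trans _ _ (\sum_(i < n) f i)); first exact: ler_sum.
have binv0 : 0 < b^-1 by rewrite invr_gt0.
rewrite -mulr_sumr ler_wpM2l //.
have := riemann_sum_le_integral _ phi phi_ge0 phi_convex phi_int _ n binv0.
by rewrite ler_pdivrMl // mulr1.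
Qed.

(* The first pile is enlarged to collect all the missing cards, so that the
   number of cards is exactly [n]; the other piles carry the shape. *)
Lemma sigma_of_convex : exists sigma, well_behaved sigma /\
  forall i, (0 < i)%N ->
    let lam := nth 0%N (stable_configuration sigma (nstar sigma n)) i in
    lam%:R <= H * phi (i.+1%:R / b) /\
    forall K, \sum_(i <= j < K)
      (Num.truncn (H * phi (j.+1%:R / b) - H * phi (j.+2%:R / b)))%:R <= lam%:R :> R.
Proof.
pose G i := (\sum_(i <= j < n) e j)%N.
pose S := (\sum_(1 <= i < n) G i)%N.
(* The value at 0 makes the first pile [n - S]. By [GS] below this value is at least [e 0], so [d]
   is still nonincreasing. *)
pose d j := if j is 0 then (n - S - G 1)%N else e j.
have dG i : (0 < i)%N -> (\sum_(i <= j < n) d j = G i)%N.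
  by move=> i0; apply: eq_big_nat => -[|j] /andP[] //; rewrite leqNgt i0.
have G0 : (G 0 = e 0 + G 1)%N by rewrite /G big_ltn.
have GS : (G 0 + S <= n)%N.
  move: mass_le; rewrite -(big_mkord xpredT G) big_ltn //.
have d_mono i j : (i <= j)%N -> (d j <= d i)%N.
  case: i j => [|i] [|j] //= ij; last exact: e_mono.
  by have := e_mono 0 j.+1 (leq0n _); lia.
have d_tail j : (n <= j)%N -> d j = 0%N.
  by case: j => [|j] nj; [lia|exact: e_tail].
have d_sum : (\sum_(i < n) \sum_(i <= j < n) d j = n)%N.
  rewrite -(big_mkord xpredT (fun i => \sum_(i <= j < n) d j)%N) big_ltn //.
  have -> : (\sum_(1 <= i < n) \sum_(i <= j < n) d j = S)%N.
    by apply: eq_big_nat => i /andP[i0 _]; exact: dG.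
  by rewrite big_ltn // dG // /d; lia.
have [sigma [sigma_wb lamE]] := sigma_of_differences d n n n_gt0 d_mono d_tail d_sum.
exists sigma; split=> // i i0 /=; rewrite lamE dG //; split; first exact: sum_e_le.
move=> K; rewrite -natr_sum ler_nat -/(f _).
case: (leqP K n) => [Kn|/ltnW nK].
  case: (leqP i K) => [iK|Ki]; last by rewrite big_geq // ltnW.
  by rewrite /G [leqRHS](big_cat_nat (n := K)) //= leq_addr.
(* The rounded drops vanish from index [n] on, so a larger [K] adds nothing. *)
have sum_tail m : (n <= m)%N -> (\sum_(m <= j < K) e j = 0)%N.
  move=> nm; rewrite big_nat_cond big1 // => j; rewrite andbT => /andP[mj _].
  by apply: e_tail; exact: leq_trans mj.
case: (leqP i n) => [iN|/ltnW ni]; last by rewrite sum_tail.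
by rewrite [leqLHS](big_cat_nat (n := n)) //= sum_tail // addn0.
Qed.

(* The loss is at most one card for each of the [K] floors, plus what lies beyond [K]. *)
Lemma sigma_of_convex_approx : exists sigma, well_behaved sigma /\
  forall i, (0 < i)%N ->
    let lam := nth 0%N (stable_configuration sigma (nstar sigma n)) i in
    lam%:R <= H * phi (i.+1%:R / b) /\
    forall K, H * phi (i.+1%:R / b) - H * phi (K.+1%:R / b) - K%:R <= lam%:R.
Proof.
have [sigma [sigma_wb lam_phi]] := sigma_of_convex.
exists sigma; split=> // i i0; have [lam_le lam_ge] := lam_phi i i0.
split=> // K; case: (leqP i K) => [iK|/ltnW/f_mono Ki]; last first.
  rewrite (@le_trans _ _ 0) // subr_le0 (@le_trans _ _ 0) //.
  by rewrite subr_le0.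
apply: le_trans (lam_ge K); rewrite -/(f i) -/(f K) -telescope_f //.
rewrite (@le_trans _ _ (\sum_(i <= j < K) (f j - f j.+1 - 1))) //.
  by rewrite [leRHS]big_split /= lerD2l sumr_const_nat mulNrn lerN2 ler_nat leq_subr.
by apply: ler_sum => j _; rewrite lerBlDr natr1 ltW // truncnS_gt.
Qed.

(* Over each cell the drop is at least the drop [k] at its right endpoint,
   which is an integer, so rounding down does not go below it. *)
Lemma sigma_of_convex_integral_slopes :
  (forall i, exists k : int, forall h, 0 < h ->
     H * (phi (i.+1%:R / b) - phi (i.+1%:R / b + h)) <= k%:~R * (b * h) /\
     (h < i.+1%:R / b -> k%:~R * (b * h) <= H * (phi (i.+1%:R / b - h) - phi (i.+1%:R / b)))) ->
  exists sigma, well_behaved sigma /\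
  forall i, (0 < i)%N ->
    let lam := nth 0%N (stable_configuration sigma (nstar sigma n)) i in
    lam%:R <= H * phi (i.+1%:R / b) /\ H * phi (i.+2%:R / b) - 1 <= lam%:R.
Proof.
move=> slopes; have [sigma [sigma_wb lam_phi]] := sigma_of_convex.
exists sigma; split=> // i i0; have [lam_le lam_ge] := lam_phi i i0; split=> //.
(* As [K >= n], the value [f K.+1] is below 1; this is the 1 lost in the conclusion. *)
pose K := (i + n)%N.
(* The integer [k] at the common endpoint of two adjacent cells lies between their drops, so the
   larger drop, rounded down, still exceeds the smaller one. The price is a shift of the index by
   one. *)
have e_ge j : f j.+1 - f j.+2 <= (e j)%:R.
  have [k slope] := slopes j.+1.
  have bV0 : 0 < b^-1 by rewrite invr_gt0.
  have [] := slope _ bV0; rewrite divff ?gt_eqF // mulr1.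
  have -> : j.+2%:R / b + b^-1 = j.+3%:R / b by rewrite -pt_step.
  have -> : j.+2%:R / b - b^-1 = j.+1%:R / b by rewrite pt_step addrK.
  rewrite !mulrBr -/(f j.+1) -/(f j.+2) -/(f j) => /le_trans fk kf.
  apply: fk; have {}kf : k%:~R <= f j - f j.+1.
    by apply: kf; rewrite ltr_pdivlMr // mulVf ?gt_eqF // ltr1n.
  case: k kf {slope} => [k|k] kf; last by apply: (@le_trans _ _ 0); rewrite ?lerz0 ?ler0n.
  by rewrite -pmulrn ler_nat truncn_ge_nat // subr_ge0 f_mono.
rewrite (le_trans _ (lam_ge K)) // (@le_trans _ _ (f i.+1 - f K.+1)) //.
  rewrite lerD2l lerN2 ltW // f_tail // /K; lia.
rewrite -telescope_f; last by rewrite /K; lia.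
rewrite big_add1 /= ler_sum //.
Qed.

End discretization.

(** Rounding moves [a n * x] by less than 1, which is negligible after division by [a n]. The shift
    [k] serves the sample points one or two cells further on. *)
Lemma cvg_truncn_div (R : realType) (a : nat -> R) (x : R) (k : nat) :
  a @ \oo --> +oo -> 0 < x ->
  (fun n => (Num.truncn (a n * x) + k)%:R / a n) @ \oo --> x.
Proof.
move=> a_infty x0.
have a_gt0 : \forall n \near \oo, 0 < a n by apply: cvgry_gt.
have aV : (fun n => (a n)^-1) @ \oo --> 0 by apply/gtr0_cvgV0.
apply: (@squeeze_cvgr _ _ _ _ (fun n => x - (a n)^-1) (fun n => x + k%:R * (a n)^-1)).
- near=> n.
  have an0 : 0 < a n by near: n.
  have /truncn_itv/andP[le_ax lt_ax] : 0 <= a n * x by rewrite mulr_ge0 ?ltW.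
  rewrite ler_pdivlMr // ler_pdivrMr // !mulrDl mulNr mulVf ?gt_eqF //.
  rewrite -mulrA mulVf ?gt_eqF // mulr1 mulrC natrD.
  have k0 : 0 <= k%:R :> R by [].
  move: lt_ax; rewrite -natr1; lra.
- by rewrite -[X in _ --> X]subr0; apply: cvgB => //; exact: cvg_cst.
- rewrite -[X in _ --> X]addr0 -[X in x + X](mulr0 k%:R).
  by apply: cvgD; [exact: cvg_cst|apply: cvgMr; exact: aV].
Unshelve. all: by end_near. Qed.

(** * One-sided slopes of convex functions *)

Section right_derivative.
Variables (R : realType) (phi : R -> R).
Hypothesis phi_convex : forall x y z : R, 0 < x -> x < y -> y < z ->
  (z - x) * phi y <= (z - y) * phi x + (y - x) * phi z.

Lemma convex_slope_mono (x h k : R) : 0 < x -> 0 < h -> h <= k ->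
  (phi (x + h) - phi x) / h <= (phi (x + k) - phi x) / k.
Proof.
move=> x0 h0; rewrite le_eqVlt => /predU1P[->//|hk].
have k0 := lt_trans h0 hk.
have := @phi_convex x (x + h) (x + k) x0.
rewrite !ltrD2l ltrDl ![x + _]addrC !addrK => /(_ h0 hk) phi_hk.
rewrite ler_pdivrMr // mulrAC ler_pdivlMr //; nra.
Qed.

(** The difference quotients decrease to the right derivative as the increment decreases to 0. *)
Lemma right_derivative_le_slope (x l h : R) : is_right_derivative phi x l ->
  0 < x -> 0 < h -> l * h <= phi (x + h) - phi x.
Proof.
move=> phi_l x0 h0; rewrite -ler_pdivlMr //.
apply: (cvgr_to_le phi_l); near=> t.
apply: convex_slope_mono => //.
by near: t; exact: nbhs_right_le.
Unshelve. all: by end_near. Qed.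

(** A chord ending at [x] is at most as steep, with sign, as any chord starting at [x]; the latter
    is shrunk to [x]. *)
Lemma right_derivative_ge_slope (x l h : R) : is_right_derivative phi x l ->
  0 < h -> h < x -> phi x - phi (x - h) <= l * h.
Proof.
move=> phi_l h0 hx; rewrite -ler_pdivrMr //.
apply: (cvgr_to_ge phi_l); near=> t.
have t0 : 0 < t by [].
have := @phi_convex (x - h) x (x + t).
rewrite subr_gt0 gtrBl ltrDl => /(_ hx h0 t0) phi_ht.
rewrite ler_pdivrMr // mulrAC ler_pdivlMr //; nra.
Unshelve. all: by end_near. Qed.

End right_derivative.

(** * Configurations with a given limit shape *)

Section limit_shape_of_convex.
Variables (R : realType) (phi : R -> R) (a : nat -> R).
Hypothesis phi_ge0 : forall x : R, 0 < x -> 0 <= phi x.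
Hypothesis a_gt0 : forall n : nat, (0 < n)%N -> 0 < a n.
Hypothesis a_infty : a @ \oo --> +oo.
Hypothesis phi_convex : forall x y z : R, 0 < x -> x < y -> y < z ->
  (z - x) * phi y <= (z - y) * phi x + (y - x) * phi z.
Hypothesis phi_int : (\int[lebesgue_measure]_(x in (`]0%R, +oo[%classic : set R))
  (phi x)%:E <= 1)%E.

(** The construction controls the piles of positive index only, and the index at [x] is eventually
    positive. *)
Let near_truncn_gt0 (x : R) : 0 < x -> \forall n \near \oo, (0 < Num.truncn (a n * x))%N.
Proof.
move=> x0; near=> n; rewrite truncn_gt0 -ler_pdivrMr //.
by near: n; apply: cvgry_ge.
Unshelve. all: by end_near. Qed.

Lemma limit_shape_of_convex0 :
  (fun n : nat => a n ^+ 2 / n%:R) @ \oo --> 0 ->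
  exists sigma : nat -> nat -> nat,
    (forall n : nat, (0 < n)%N -> well_behaved (sigma n)) /\
    is_limit_shape sigma a phi.
Proof.
move=> a_sqr.
have /choice[sigma sigmaP] n : exists sigma, (0 < n)%N ->
    well_behaved sigma /\ forall i, (0 < i)%N ->
    let lam := nth 0%N (stable_configuration sigma (nstar sigma n)) i in
    lam%:R <= n%:R / a n * phi (i.+1%:R / a n) /\
    forall K, n%:R / a n * phi (i.+1%:R / a n)
      - n%:R / a n * phi (K.+1%:R / a n) - K%:R <= lam%:R.
  case: (posnP n) => [->|n0]; first by exists id.
  have an0 := a_gt0 n n0.
  have [sigma sigmaP] : exists sigma, well_behaved sigma /\ forall i, (0 < i)%N ->
      let lam := nth 0%N (stable_configuration sigma (nstar sigma n)) i in
      lam%:R <= n%:R / a n * phi (i.+1%:R / a n) /\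
      forall K, n%:R / a n * phi (i.+1%:R / a n)
      - n%:R / a n * phi (K.+1%:R / a n) - K%:R <= lam%:R.
    apply: sigma_of_convex_approx => //; first by rewrite divr_ge0 // ltW.
    by rewrite divfK // gt_eqF.
  by exists sigma.
exists sigma; split=> [n n0|x x0]; first by case: (sigmaP n n0).
have phi_u : (fun n => phi ((Num.truncn (a n * x) + 1)%:R / a n)) @ \oo --> phi x.
  apply: (@continuous_cvg _ _ _ _ _ _ phi); first exact: convex_gt0_continuous.
  exact: cvg_truncn_div.
apply/cvgrPdist_le => eps eps0.
(* Three errors of [eps / 3]: continuity at [x]; the tail, since [phi <= 1 / M] beyond [M]; and the
   floors up to index [a n * M], which after scaling cost at most [a n ^+ 2 / n * M]. *)
pose M := 3 / eps; have M0 : 0 < M by rewrite divr_gt0.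
have eps3 : 0 < eps / 3 by rewrite divr_gt0.
have eps3M : 0 < eps / 3 / M by rewrite divr_gt0.
move/cvgrPdist_le : phi_u => /(_ _ eps3) near_u.
move/cvgrPdist_le : a_sqr => /(_ _ eps3M) near_sqr.
near=> n.
have n0 : (0 < n)%N by near: n; exact: nbhs_infty_gt.
have an0 := a_gt0 n n0; have n0' : 0 < n%:R :> R by rewrite ltr0n.
have i0 : (0 < Num.truncn (a n * x))%N by near: n; exact: near_truncn_gt0.
have uP : `|phi x - phi ((Num.truncn (a n * x) + 1)%:R / a n)| <= eps / 3.
  by near: n; exact: near_u.
have sqrP : `|0 - a n ^+ 2 / n%:R| <= eps / 3 / M by near: n; exact: near_sqr.
have [_ /(_ _ i0)[]] := sigmaP n n0.
set lam := nth _ _ _; rewrite -addn1 => lam_le /(_ (Num.truncn (a n * M))).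
set u := phi ((Num.truncn (a n * x) + 1)%:R / a n) in uP lam_le *; set K := Num.truncn (a n * M).
have /truncn_itv/andP[KM MK] : 0 <= a n * M by rewrite mulr_ge0 // ltW.
have phiK : phi (K.+1%:R / a n) <= eps / 3.
  have MKa : M <= K.+1%:R / a n by rewrite ler_pdivlMr // mulrC ltW.
  have K0 : 0 < K.+1%:R / a n by rewrite divr_gt0.
  have := integrable_convex_le_inv _ phi phi_ge0 phi_convex phi_int _ K0.
  have -> : eps / 3 = M^-1 by rewrite /M invf_div.
  rewrite -ler_pdivlMl // mulr1 => /le_trans; apply.
  by rewrite lef_pV2.
have w0 : 0 <= a n / n%:R by rewrite divr_ge0 // ltW.
have aK : a n / n%:R * K%:R <= eps / 3.
  apply: (@le_trans _ _ (a n ^+ 2 / n%:R * M)).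
    have -> : a n ^+ 2 / n%:R * M = a n / n%:R * (a n * M) by ring.
    exact: ler_wpM2l.
  rewrite -ler_pdivlMr //; apply: le_trans sqrP.
  by rewrite sub0r normrN ler_norm.
have lamE v : a n / n%:R * (n%:R / a n * v) = v by field; rewrite !gt_eqF.
move=> /(ler_wpM2l w0); rewrite !mulrBr !lamE => lam_ge.
move/(ler_wpM2l w0) : lam_le; rewrite lamE => lam_le.
move: uP; rewrite !ler_norml => /andP[u1 u2]; apply/andP; split; lra.
Unshelve. all: by end_near. Qed.

(** A grid of mesh [1 / b n] with [b n ^+ 2 = c * n] turns a slope [k * c] into a change of exactly
    [k] cards per cell. The ratio [a n / b n] tends to 1, so the change of grid disappears in the
    limit. *)
Lemma limit_shape_of_convex_slopes (c : R) : 0 < c ->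
  (fun n : nat => a n ^+ 2 / n%:R) @ \oo --> c ->
  (forall x : R, 0 < x -> exists k : int, is_right_derivative phi x (k%:~R * c)) ->
  exists sigma : nat -> nat -> nat,
    (forall n : nat, (0 < n)%N -> well_behaved (sigma n)) /\
    is_limit_shape sigma a phi.
Proof.
move=> c0 a_sqr slopes; pose b (n : nat) : R := Num.sqrt (c * n%:R).
have b_gt0 n : (0 < n)%N -> 0 < b n by move=> n0; rewrite sqrtr_gt0 mulr_gt0 // ltr0n.
have b2 n : b n ^+ 2 = c * n%:R by rewrite sqr_sqrtr // mulr_ge0 // ltW.
have /choice[sigma sigmaP] n : exists sigma, (0 < n)%N ->
    well_behaved sigma /\ forall i, (0 < i)%N ->
    let lam := nth 0%N (stable_configuration sigma (nstar sigma n)) i in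
    lam%:R <= b n / c * phi (i.+1%:R / b n) /\
    b n / c * phi (i.+2%:R / b n) - 1 <= lam%:R.
  case: (posnP n) => [->|n0]; first by exists id.
  have bn0 := b_gt0 n n0.
  have [sigma sigmaP] : exists sigma, well_behaved sigma /\ forall i, (0 < i)%N ->
      let lam := nth 0%N (stable_configuration sigma (nstar sigma n)) i in
      lam%:R <= b n / c * phi (i.+1%:R / b n) /\
      b n / c * phi (i.+2%:R / b n) - 1 <= lam%:R.
    apply: sigma_of_convex_integral_slopes => //.
    - by rewrite divr_ge0 // ltW.
    - by rewrite mulrAC -expr2 b2 mulrAC divff ?gt_eqF // mul1r.
    - move=> i; have xi0 : 0 < i.+1%:R / b n by rewrite divr_gt0.
      (* The discretization counts drops, which have the opposite sign to slopes. *)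
      have [k phi_k] := slopes _ xi0; exists (- k) => h h0.
      have -> : (- k)%:~R * (b n * h) = b n / c * - (k%:~R * c * h).
        by rewrite mulrNz; field; rewrite gt_eqF.
      have bc0 : 0 <= b n / c by rewrite divr_ge0 // ltW.
      split=> [|hx]; rewrite ler_wpM2l //.
        by rewrite lerNr opprB; exact: right_derivative_le_slope.
      by rewrite lerNl opprB; exact: right_derivative_ge_slope.
  by exists sigma.
exists sigma; split=> [n n0|x x0]; first by case: (sigmaP n n0).
pose r (n : nat) : R := a n / b n.
(* The square of [r n] is [a n ^+ 2 / n / c], which tends to 1. *)
have r1 : r @ \oo --> (1 : R).
  have : (fun n => Num.sqrt (a n ^+ 2 / n%:R / c)) @ \oo --> (1 : R).
    rewrite -[X in _ --> X](sqrtr1 R) -[X in Num.sqrt X](@divff _ c) ?gt_eqF //.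
    apply: (@continuous_cvg _ _ _ _ _ _ (@Num.sqrt R)); first exact: sqrt_continuous.
    by apply: cvgMl; exact: a_sqr.
  apply: cvg_trans; apply: near_eq_cvg; near=> n.
  have n0 : (0 < n)%N by near: n; exact: nbhs_infty_gt.
  have an0 := a_gt0 n n0; have n0' : 0 < n%:R :> R by rewrite ltr0n.
  have -> : a n ^+ 2 / n%:R / c = r n ^+ 2.
    by rewrite /r expr_div_n b2; field; rewrite !gt_eqF.
  by rewrite sqrtr_sqr ger0_norm // divr_ge0 // ltW // b_gt0.
have u_cvg k : (fun n => phi ((Num.truncn (a n * x) + k)%:R / b n)) @ \oo --> phi x.
  apply: (@continuous_cvg _ _ _ _ _ _ phi); first exact: convex_gt0_continuous.
  have : (fun n => (Num.truncn (a n * x) + k)%:R / a n * r n) @ \oo --> x.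
    by rewrite -[X in _ --> X]mulr1; apply: cvgM => //; exact: cvg_truncn_div.
  apply: cvg_trans; apply: near_eq_cvg; near=> n.
  have n0 : (0 < n)%N by near: n; exact: nbhs_infty_gt.
  by rewrite /r; field; rewrite !gt_eqF ?a_gt0 ?b_gt0.
(* The card lost in the lower bound weighs [a n / n], the product of [a n ^+ 2 / n] and
   [1 / a n]. *)
have an_cvg : (fun n => a n / n%:R) @ \oo --> (0 : R).
  have aV : (fun n => (a n)^-1) @ \oo --> (0 : R).
    by apply/gtr0_cvgV0 => //; apply: cvgry_gt.
  have : (fun n => a n ^+ 2 / n%:R * (a n)^-1) @ \oo --> (0 : R).
    by rewrite -[X in _ --> X](mulr0 c); apply: cvgM.
  apply: cvg_trans; apply: near_eq_cvg; near=> n.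
  have n0 : (0 < n)%N by near: n; exact: nbhs_infty_gt.
  by field; rewrite !gt_eqF ?a_gt0 // ltr0n.
apply: (@squeeze_cvgr _ _ _ _
  (fun n => r n * phi ((Num.truncn (a n * x) + 2)%:R / b n) - a n / n%:R)
  (fun n => r n * phi ((Num.truncn (a n * x) + 1)%:R / b n))); last 2 first.
- rewrite -[X in _ --> X]subr0; apply: cvgB => //.
  by rewrite -[X in _ --> X]mul1r; apply: cvgM.
- by rewrite -[X in _ --> X]mul1r; apply: cvgM.
near=> n.
have n0 : (0 < n)%N by near: n; exact: nbhs_infty_gt.
have i0 : (0 < Num.truncn (a n * x))%N by near: n; exact: near_truncn_gt0.
have an0 := a_gt0 n n0; have n0' : 0 < n%:R :> R by rewrite ltr0n.
have bn0 := b_gt0 n n0.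
have w0 : 0 <= a n / n%:R by rewrite divr_ge0 // ltW.
have rE : r n = a n / n%:R * (b n / c).
  by rewrite mulrACA -[n%:R^-1 * c^-1]invfM [n%:R * c]mulrC -b2 /r expr2; field; rewrite gt_eqF.
have [_ /(_ _ i0)[lam_le lam_ge]] := sigmaP n n0.
rewrite addn1 addn2 rE -!(mulrA (a n / n%:R)); apply/andP; split.
  by move/(ler_wpM2l w0) : lam_ge; rewrite mulrBr mulr1.
exact: ler_wpM2l.
Unshelve. all: by end_near. Qed.

End limit_shape_of_convex.

(** * Limits of convex integer sequences *)

Section discrete_convexity.
Variable L : nat -> nat.
Hypothesis L_mono : forall i j, (i <= j)%N -> (L j <= L i)%N.
Hypothesis L_convex : forall i, (L i.+1 - L i.+2 <= L i - L i.+1)%N.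

Let D_mono i k : (L (i + k) - L (i + k).+1 <= L i - L i.+1)%N.
Proof.
elim: k => [|k IHk]; first by rewrite addn0.
by rewrite addnS (leq_trans (L_convex _)).
Qed.

Lemma discrete_convex_drop_le p q : (p <= q)%N ->
  (L p - L q <= (q - p) * (L p - L p.+1))%N.
Proof.
move/subnKC <-; rewrite addKn; elim: (q - p)%N => [|k IHk].
  by rewrite addn0 subnn.
have := D_mono p k; have := L_mono (p + k) (p + k).+1 (leqnSn _).
have := L_mono p (p + k) (leq_addr _ _); rewrite addnS mulSn; lia.
Qed.

Lemma discrete_convex_drop_ge p q : (p <= q)%N ->
  ((q - p) * (L q - L q.+1) <= L p - L q)%N.
Proof.
move/subnKC <-; rewrite addKn; elim: (q - p)%N => [|k IHk] //.
have := L_convex (p + k); have := L_mono (p + k) (p + k).+1 (leqnSn _).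
have := L_mono p (p + k) (leq_addr _ _); rewrite addnS.
set u := (L (p + k).+1 - L (p + k).+2)%N; set v := (L (p + k) - L (p + k).+1)%N in IHk *.
move=> L1 L2 uv; have : (k.+1 * u <= k.+1 * v)%N by rewrite leq_mul2l uv orbT.
rewrite [(k.+1 * v)%N]mulSn /v in IHk *; lia.
Qed.

(** The single drop at [q] separates the average drops on its two sides. *)
Lemma discrete_convex3 p q r : (p <= q)%N -> (q <= r)%N ->
  ((q - p) * (L q - L r) <= (r - q) * (L p - L q))%N.
Proof.
move=> pq qr.
have := discrete_convex_drop_le q r qr; have := discrete_convex_drop_ge p q pq.
move=> ge_q le_q; apply: leq_trans (leq_mul (leqnn (q - p)) le_q) _.
by rewrite mulnCA leq_mul2l ge_q orbT.
Qed.
End discrete_convexity.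

(** * Configurations as step functions *)

Section step_functions.
Variables (R : realType) (a k : R) (s : seq nat).
Hypothesis k_ge0 : 0 <= k.
Hypothesis a_gt0 : 0 < a.

Let cell (i : nat) : set R := `[i%:R / a, i.+1%:R / a[%classic.
Let measurable_cell i : measurable (cell i). Proof. exact: measurable_itv. Qed.
Let step (i : nat) (x : R) : \bar R := ((k * (nth 0%N s i)%:R)%:E * (\1_(cell i) x)%:E)%E.

(** On the half-open cell [i] the rounded index is [i], so the scaled step function is a finite sum
    of indicators; indices past the end of [s] give 0. *)
Let stepE x : 0 < x ->
  ((k * (nth 0%N s (Num.truncn (a * x)))%:R)%:E =
   \sum_(0 <= i < size s) step i x)%E.
Proof.
move=> x0; set j := Num.truncn _.
have stepj i : step i x = if i == j then (k * (nth 0%N s i)%:R)%:E else 0%E.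
  rewrite /step /cell indicE mem_setE in_itv /= ler_pdivrMr // ltr_pdivlMr //.
  rewrite ![x * a]mulrC -truncn_eq ?mulr_ge0 ?ltW // eq_sym.
  by case: eqP => _; rewrite ?mule1 ?mule0.
rewrite (eq_bigr _ (fun i _ => stepj i)) -big_mkcond big_nat1_eq /=.
by case: ltnP => // sj; rewrite nth_default // mulr0.
Qed.

Let measurable_step i :
  measurable_fun (`]0, +oo[%classic : set R) (step i).
Proof.
by apply/measurable_EFinP; apply: measurable_funM.
Qed.

Lemma measurable_step_function : measurable_fun (`]0, +oo[%classic : set R)
  (fun x => (k * (nth 0%N s (Num.truncn (a * x)))%:R)%:E).
Proof.
apply: (eq_measurable_fun (fun x => \sum_(0 <= i < size s) step i x)%E); last first.
  by apply: emeasurable_sum => i; exact: measurable_step.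
by move=> x; rewrite inE /= in_itv /= andbT => /stepE.
Qed.

(** Each pile contributes its scaled height times the length [1 / a] of its cell. For [k = a / n]
    the bound becomes the number of cards divided by [n]. *)
Lemma integral_step_function_le :
  (\int[lebesgue_measure]_(x in (`]0%R, +oo[%classic : set R))
     (k * (nth 0%N s (Num.truncn (a * x)))%:R)%:E <= (k * (sumn s)%:R / a)%:E)%E.
Proof.
rewrite [leLHS](_ : _ = \int[lebesgue_measure]_(x in (`]0%R, +oo[%classic : set R))
    (\sum_(0 <= i < size s) step i x))%E; last first.
  by apply: eq_integral => x; rewrite inE /= in_itv /= andbT => /stepE.
rewrite ge0_integral_sum //; last first.
  by move=> i x _; rewrite mule_ge0 // lee_fin ?mulr_ge0.
rewrite (@le_trans _ _ (\sum_(0 <= i < size s) (k * (nth 0%N s i)%:R / a)%:E)%E) //.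
  apply: lee_sum => i _; rewrite ge0_integralZl_EFin //; last 2 first.
  - by apply/measurable_EFinP; apply: measurable_indic; exact: measurable_cell.
  - by rewrite mulr_ge0.
  rewrite integral_indic //; last exact: measurable_itv.
  change ((k * (nth 0%N s i)%:R)%:E * lebesgue_measure (cell i `&` `]0%R, +oo[) <=
    (k * (nth 0%N s i)%:R)%:E * (a^-1)%:E)%E.
  apply: lee_wpmul2l; first by rewrite lee_fin mulr_ge0.
  (* Cell 0 contains the point 0, which lies outside the domain; the measure of the whole cell is an
     upper bound. *)
  apply: (@le_trans _ _ (lebesgue_measure (cell i))).
    apply: le_measure; last exact: subIsetl.
      by rewrite inE; apply: measurableI; exact: measurable_itv.
    by rewrite inE; exact: measurable_itv.
  rewrite lebesgue_measure_itv /=; case: ifP => _; last by rewrite lee_fin invr_ge0 ltW.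
  by rewrite -EFinB lee_fin -mulrBl -natrB // subSnn mul1r.
by rewrite sumEFin lee_fin -mulr_suml -mulr_sumr sumnE (big_nth 0%N) natr_sum.
Qed.

End step_functions.

(** * Convexity, integral and slopes of limit shapes *)

Section limit_shape.
Variables (R : realType) (phi : R -> R) (a : nat -> R) (lam : nat -> seq nat).
Hypothesis a_gt0 : forall n : nat, (0 < n)%N -> 0 < a n.
Hypothesis a_infty : a @ \oo --> +oo.
Hypothesis lam_mono : forall n i j, (0 < n)%N -> (i <= j)%N ->
  (nth 0%N (lam n) j <= nth 0%N (lam n) i)%N.
Hypothesis lam_convex : forall n i, (0 < n)%N ->
  (nth 0%N (lam n) i.+1 - nth 0%N (lam n) i.+2 <= nth 0%N (lam n) i - nth 0%N (lam n) i.+1)%N.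
Hypothesis lam_sum : forall n, (0 < n)%N -> (sumn (lam n) <= n)%N.
Hypothesis lam_phi : forall x : R, 0 < x ->
  (fun n : nat => a n / n%:R *
    (nth 0%N (lam n) (Num.truncn (a n * x)))%:R) @ \oo --> phi x.

Let near_gt0 : \forall n \near \oo, (0 < n)%N. Proof. exact: nbhs_infty_gt. Qed.

Let idx n (x : R) := Num.truncn (a n * x).

Let idx_mono n x y : (0 < n)%N -> x <= y -> (idx n x <= idx n y)%N.
Proof. by move=> n0 xy; rewrite le_truncn // ler_pM2l // a_gt0. Qed.

Let idx_cvg x y : 0 < x -> x < y ->
  (fun n => (idx n y - idx n x)%N%:R / a n) @ \oo --> y - x.
Proof.
move=> x0 xy; have y0 := lt_trans x0 xy.
have : (fun n => (idx n y + 0)%N%:R / a n - (idx n x + 0)%N%:R / a n) @ \oo --> y - x.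
  by apply: cvgB; exact: cvg_truncn_div.
apply: cvg_trans; apply: near_eq_cvg; near=> n.
have n0 : (0 < n)%N by near: n; exact: near_gt0.
by rewrite !addn0 -mulrBl natrB // idx_mono // ltW.
Unshelve. all: by end_near. Qed.

Let drop_cvg x y : 0 < x -> x < y ->
  (fun n => a n / n%:R * (nth 0%N (lam n) (idx n x) - nth 0%N (lam n) (idx n y))%N%:R)
     @ \oo --> phi x - phi y.
Proof.
move=> x0 xy; have y0 := lt_trans x0 xy.
have : (fun n => a n / n%:R * (nth 0%N (lam n) (idx n x))%:R
    - a n / n%:R * (nth 0%N (lam n) (idx n y))%:R) @ \oo --> phi x - phi y.
  by apply: cvgB; exact: lam_phi.
apply: cvg_trans; apply: near_eq_cvg; near=> n.
have n0 : (0 < n)%N by near: n; exact: near_gt0.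
by rewrite natrB ?mulrBr // lam_mono // idx_mono // ltW.
Unshelve. all: by end_near. Qed.

Lemma limit_shape_nonincreasing x y : 0 < x -> x <= y -> phi y <= phi x.
Proof.
move=> x0 xy; apply: (ler_cvg_to (lam_phi y (lt_le_trans x0 xy)) (lam_phi x x0)).
near=> n; have n0 : (0 < n)%N by near: n; exact: near_gt0.
have w0 : 0 <= a n / n%:R by rewrite divr_ge0 // ltW // a_gt0.
by rewrite ler_wpM2l // ler_nat lam_mono // idx_mono.
Unshelve. all: by end_near. Qed.

(** Discrete convexity at the indices of [x], [y] and [z], with lengths scaled by [1 / a n] and
    heights by [a n / n], passes to the limit. *)
Lemma limit_shape_convex x y z : 0 < x -> x < y -> y < z ->
  (z - x) * phi y <= (z - y) * phi x + (y - x) * phi z.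
Proof.
move=> x0 xy yz; have y0 := lt_trans x0 xy.
suff : (y - x) * (phi y - phi z) <= (z - y) * (phi x - phi y) by lra.
apply: (ler_cvg_to (cvgM (idx_cvg x y x0 xy) (drop_cvg y z y0 yz))
                   (cvgM (idx_cvg y z y0 yz) (drop_cvg x y x0 xy))).
near=> n; have n0 : (0 < n)%N by near: n; exact: near_gt0.
have an0 := a_gt0 n n0.
have w0 : 0 <= (a n)^-1 * (a n / n%:R).
  by rewrite mulr_ge0 ?divr_ge0 ?invr_ge0 // ltW.
have regroup (X Y : R) : X / a n * (a n / n%:R * Y) = (a n)^-1 * (a n / n%:R) * (X * Y).
  by ring.
rewrite /= !regroup ler_wpM2l // -!natrM ler_nat.
apply: discrete_convex3; rewrite ?idx_mono ?ltW // => i.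
- by move=> j; exact: lam_mono.
- exact: lam_convex.
Unshelve. all: by end_near. Qed.

Lemma limit_shape_integral_le :
  (\int[lebesgue_measure]_(x in (`]0%R, +oo[%classic : set R)) (phi x)%:E <= 1)%E.
Proof.
(* The sequence is shifted by one because the hypotheses start at [n = 1]. *)
pose u n (x : R) := (a n.+1 / n.+1%:R * (nth 0%N (lam n.+1) (idx n.+1 x))%:R)%:E.
have u_phi x : 0 < x -> limn_einf (u ^~ x) = (phi x)%:E.
  move=> x0; have : (u ^~ x) @ \oo --> (phi x)%:E.
    apply: cvg_EFin; first by near=> n.
    have := lam_phi x x0; rewrite -cvg_shiftS; exact: cvg_trans.
  by move/cvg_limn_einf_sup => [].
have w0 n : 0 <= a n.+1 / n.+1%:R by rewrite divr_ge0 // ltW // a_gt0.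
rewrite [leLHS](_ : _ = \int[lebesgue_measure]_(x in (`]0%R, +oo[%classic : set R))
    limn_einf (u ^~ x))%E; last first.
  by apply: eq_integral => x; rewrite inE /= in_itv /= andbT => /u_phi.
apply: (le_trans (fatou _ _ _ _)) => //.
- by move=> n; apply: measurable_step_function => //; exact: a_gt0.
- by move=> n x _; rewrite lee_fin mulr_ge0.
rewrite limn_einf_lim; apply: lime_le; first exact: is_cvg_einfs.
near=> n; apply: (@le_trans _ _
    (\int[lebesgue_measure]_(x in (`]0%R, +oo[%classic : set R)) u n x)%E).
  by apply: ereal_inf_lbound; exists n => /=.
apply: (le_trans (integral_step_function_le _ _ _ _ _ _)) => //; first exact: a_gt0.
have an0 := a_gt0 n.+1 (ltn0Sn n).
rewrite lee_fin ler_pdivrMr // mul1r -mulrA ler_piMr //; first exact: ltW.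
by rewrite ler_pdivrMl // mulr1 ler_nat lam_sum.
Unshelve. all: by end_near. Qed.

Section integral_slopes.
Variable c : R.
Hypothesis c_gt0 : 0 < c.
Hypothesis a_sqr : (fun n : nat => a n ^+ 2 / n%:R) @ \oo --> c.

(* The differences of the configurations are integers: as soon as they drop
   below [m.+1] on average, they are at most [m] from there on. *)
Lemma limit_shape_slope_gap (m : nat) (x y z : R) : 0 < x -> x < y -> y < z ->
  phi x - phi y < m.+1%:R * c * (y - x) -> phi y - phi z <= m%:R * c * (z - y).
Proof.
move=> x0 xy yz phi_xy; have y0 := lt_trans x0 xy.
(* A drop of [k] cards per index becomes a drop of [k * c] per unit length: the expression is
   [k * (a n ^+ 2 / n)] times the rescaled number of indices. *)
have scale_cvg (k : nat) (s t : R) : 0 < s -> s < t ->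
    (fun n => a n / n%:R * (k * (idx n t - idx n s))%N%:R) @ \oo --> k%:R * c * (t - s).
  move=> s0 st; have : (fun n => k%:R * (a n ^+ 2 / n%:R) * ((idx n t - idx n s)%N%:R / a n))
      @ \oo --> k%:R * c * (t - s).
    by apply: cvgM; [apply: cvgMr; exact: a_sqr|exact: idx_cvg].
  apply: cvg_trans; apply: near_eq_cvg; near=> n.
  have n0 : (0 < n)%N by near: n; exact: near_gt0.
  by rewrite natrM; field; rewrite !gt_eqF ?a_gt0 ?ltr0n.
apply: (ler_cvg_to (drop_cvg y z y0 yz) (scale_cvg m y z y0 yz)).
have lt_drop : \forall n \near \oo,
    a n / n%:R * (nth 0%N (lam n) (idx n x) - nth 0%N (lam n) (idx n y))%N%:R <
    a n / n%:R * (m.+1 * (idx n y - idx n x))%N%:R.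
  have diff_cvg : (fun n => a n / n%:R * (m.+1 * (idx n y - idx n x))%N%:R -
      a n / n%:R * (nth 0%N (lam n) (idx n x) - nth 0%N (lam n) (idx n y))%N%:R)
      @ \oo --> m.+1%:R * c * (y - x) - (phi x - phi y).
    by apply: cvgB; [exact: scale_cvg|exact: drop_cvg].
  have diff_gt0 : 0 < m.+1%:R * c * (y - x) - (phi x - phi y) by rewrite subr_gt0.
  near=> n; rewrite -subr_gt0; near: n.
  exact: (cvgr_gt _ diff_cvg).
near=> n; have n0 : (0 < n)%N by near: n; exact: near_gt0.
have w0 : 0 < a n / n%:R by rewrite divr_gt0 ?a_gt0 ?ltr0n.
rewrite ler_pM2l // ler_nat.
have : a n / n%:R * (nth 0%N (lam n) (idx n x) - nth 0%N (lam n) (idx n y))%N%:R <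
    a n / n%:R * (m.+1 * (idx n y - idx n x))%N%:R by near: n; exact: lt_drop.
rewrite ltr_pM2l // ltr_nat => lt_m.
have mono i j := lam_mono n i j n0; have convex i := lam_convex n i n0.
have := discrete_convex_drop_ge _ mono convex _ _ (idx_mono n x y n0 (ltW xy)).
move=> /leq_ltn_trans /(_ lt_m); rewrite mulnC ltn_mul2r ltnS => /andP[_ Dm].
apply: leq_trans (discrete_convex_drop_le _ mono convex _ _ (idx_mono n y z n0 (ltW yz))) _.
by rewrite mulnC leq_mul2r Dm orbT.
Unshelve. all: by end_near. Qed.

(** Let [l] be the right derivative and [m] the floor of [- l / c], so that [l <= - m * c]. The gap
    between admissible slopes limits the drop after [x] to rate [m * c], which gives the reverse
    inequality. *)
Lemma limit_shape_integral_slopes (x : R) : 0 < x ->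
  exists k : int, is_right_derivative phi x (k%:~R * c).
Proof.
move=> x0; pose s h := (phi (x + h) - phi x) / h.
have [l phi_l] : exists l, is_right_derivative phi x l.
  exists (inf (s @` `]0, +oo[)).
  apply: nondecreasing_at_right_cvgr => //.
    move=> h k; rewrite !in_itv /= !andbT => h0 k0 hk.
    exact: (convex_slope_mono _ _ limit_shape_convex).
  (* The slope of a chord to the left of [x] bounds the difference quotients from below. *)
  exists ((phi x - phi (x / 2)) / (x / 2)) => _ [h /= + <-].
  rewrite in_itv /= andbT => h0.
  have := limit_shape_convex (x / 2) x (x + h).
  have x2 : 0 < x / 2 by rewrite divr_gt0.
  have xE : x = x / 2 + x / 2 by lra.
  move=> /(_ x2) phi_h.
  rewrite /s ler_pdivrMr // mulrAC ler_pdivlMr //.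
  have := phi_h ltac:(lra) ltac:(lra); nra.
have slope h : 0 < h -> l * h <= phi (x + h) - phi x.
  exact: (right_derivative_le_slope _ _ limit_shape_convex _ _ _ phi_l).
have l_le0 : l <= 0.
  rewrite -(ler_pM2r x0) mul0r; apply: le_trans (slope x x0) _; rewrite subr_le0.
  by apply: limit_shape_nonincreasing => //; rewrite lerDl ltW.
have lc0 : 0 <= - l / c by rewrite divr_ge0 ?oppr_ge0 // ltW.
set m := Num.truncn (- l / c); have /andP[m_le lt_m] := truncn_itv lc0.
rewrite -/m ler_pdivlMr // in m_le; rewrite -/m ltr_pdivrMr // in lt_m.
(* Chords from [x] have slope at least [l], and [l > - m.+1 * c], so the average drop over [[x, y]]
   is small enough for the gap. *)
have gap y z : x < y -> y < z -> phi y - phi z <= m%:R * c * (z - y).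
  move=> xy yz; apply: (limit_shape_slope_gap m x) => //.
  have yx : 0 < y - x by rewrite subr_gt0.
  have := slope _ yx; rewrite subrKC -(ltr_pM2r yx) in lt_m *; lra.
(* The gap bound starts at points beyond [x], so it is applied from [x + t]. The choice of [t] makes
   the drop over [[x, x + t]], at most [- l * t], no more than [eps]; [1 - l] is positive even if
   [l = 0]. *)
have gapx h : 0 < h -> phi x - phi (x + h) <= m%:R * c * h.
  move=> h0; apply/ler_addgt0Pr => eps eps0.
  have l1 : 0 < 1 - l by rewrite subr_gt0 (le_lt_trans l_le0).
  pose t := Num.min (h / 2) (eps / (1 - l)).
  have t0 : 0 < t by rewrite lt_min !divr_gt0.
  have th : t < h by rewrite gt_min ltr_pdivrMr // ltr_pMr // ltr1n.
  have tl : t * (1 - l) <= eps by rewrite -ler_pdivlMr // ge_min lexx orbT.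
  have mc0 : 0 <= m%:R * c by rewrite mulr_ge0 // ltW.
  have := slope t t0; have := gap (x + t) (x + h).
  have := mulr_ge0 mc0 (ltW t0).
  rewrite ltrDl ltrD2l => mct /(_ t0 th) gap_t slope_t; lra.
exists (- m%:Z); suff -> : (- m%:Z)%:~R * c = l by [].
rewrite mulrNz -pmulrn; apply/le_anti/andP; split; last by lra.
apply: (cvgr_to_ge phi_l); near=> h.
have h0 : 0 < h by [].
have := gapx h h0; rewrite ler_pdivlMr //; lra.
Unshelve. all: by end_near. Qed.

End integral_slopes.
End limit_shape.

Theorem theorem3 (R : realType) (phi : R -> R) (a : nat -> R) (c : R)
    (phi_ge0 : forall x : R, 0 < x -> 0 <= phi x)
    (a_gt0 : forall n : nat, (0 < n)%N -> 0 < a n)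
    (a_infty : a @ \oo --> +oo)
    (c_ge0 : 0 <= c)
    (a_sqr : (fun n : nat => a n ^+ 2 / n%:R) @ \oo --> c) :
  (exists sigma : nat -> nat -> nat,
      (forall n : nat, (0 < n)%N -> well_behaved (sigma n)) /\
      is_limit_shape sigma a phi)
  <->
  [/\ convex_function (`]0, +oo[%classic : set R^o) phi,
      (\int[lebesgue_measure]_(x in (`]0, +oo[%classic : set R)%R) (phi x)%:E <= 1)%E
    & 0 < c -> forall x : R, 0 < x ->
        exists k : int, is_right_derivative phi x (k%:~R * c)].
Proof.
split=> [[sigma [sigma_wb sigma_phi]]|[phi_conv phi_int phi_slopes]].
  pose lam n := stable_configuration (sigma n) (nstar (sigma n) n).
  have lam_st n := stable_configuration_nstarP (sigma n) n.
  have lam_mono n i j : (0 < n)%N -> (i <= j)%N ->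
      (nth 0%N (lam n) j <= nth 0%N (lam n) i)%N.
    by move=> _; case: (lam_st n) => -[lam_sorted _ _] _; exact: sorted_geq_nth.
  have lam_convex n i : (0 < n)%N -> (nth 0%N (lam n) i.+1 - nth 0%N (lam n) i.+2 <=
      nth 0%N (lam n) i - nth 0%N (lam n) i.+1)%N.
    by move=> n0; exact: (stable_configuration_convex _ (sigma_wb n n0) _ _ (lam_st n)).
  have lam_sum n : (0 < n)%N -> (sumn (lam n) <= n)%N.
    by move=> _; case: (lam_st n) => -[_ _ ->] _; exact: nstar_le.
  split.
  - apply/convex_function_gt0E.
    exact: (limit_shape_convex _ _ _ _ a_gt0 a_infty lam_mono lam_convex sigma_phi).
  - exact: (limit_shape_integral_le _ _ _ _ a_gt0 lam_sum sigma_phi).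
  - move=> c0 x x0; exact: (limit_shape_integral_slopes _ _ _ _ a_gt0 a_infty
      lam_mono lam_convex sigma_phi _ c0 a_sqr _ x0).
move/convex_function_gt0E : phi_conv => phi_convex.
move: c_ge0; rewrite le_eqVlt => /predU1P[c0|c_gt0].
  by apply: limit_shape_of_convex0 => //; rewrite c0.
exact: (limit_shape_of_convex_slopes _ _ _ phi_ge0 a_gt0 a_infty phi_convex
  phi_int _ c_gt0 a_sqr (phi_slopes c_gt0)).
Qed.
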